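(* Let $F$ be a field, let $V$ be a four-dimensional vector space over $F$, and let $C$ be a plane of $\mathbb{P}(V\wedge V)$ that has no point in common with the Klein quadric $\mathcal{Q}$. Then the relation $\parallel_C$ on the set of lines of $\mathbb{P}(V)$ is a parallelism of $\mathbb{P}(V)$. All its parallel classes are regular spreads.
   Context: Fields are commutative and of arbitrary characteristic. For a vector space $U$ over $F$, $\mathbb{P}(U)$ is the projective space of all subspaces of $U$; points, lines, planes and solids are the subspaces of vector dimension $1,2,3,4$. The Plücker embedding $\gamma$ maps a line $M$ of $\mathbb{P}(V)$ to the point $M^\gamma=F(u\wedge v)$ of $\mathbb{P}(V\wedge V)$, where $u,v$ is any basis of $M$; the Klein quadric $\mathcal{Q}$ is the image of $\gamma$. Lines $M,N$ of $\mathbb{P}(V)$ satisfy $M\parallel_C N$ if $C+M^\gamma=C+N^\gamma$. A parallelism of $\mathbb{P}(V)$ is an equivalence relation on the set of lines such that each point is incident with precisely one line from each equivalence class; the equivalence classes are the parallel classes. A spread is a set of lines of $\mathbb{P}(V)$ such that each point is incident with precisely one of them. The regular spreads are precisely the elliptic linear congruences of lines, i.e. the sets of lines of the form $\{X\mid X^\gamma\subset T\}$ where $T$ is a solid of $\mathbb{P}(V\wedge V)$ such that the section of $\mathcal{Q}$ by $T$ is an elliptic (ovoidal) quadric of $\mathbb{P}(T)$; the latter holds precisely when the line $T^\perp$ has no point in common with $\mathcal{Q}$. Here $X^\perp=\{y\in V\wedge V\mid x\wedge y=0\text{ in }\bigwedge^4V\text{ for all }x\in X\}$ is the polarity of the Klein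 quadric. *)

(* Defs.v *)
From HB Require Import structures.
From mathcomp Require Import all_boot all_order all_algebra.
From mathcomp Require Import ring.
From Stdlib Require Import RelationClasses.

Set Implicit Arguments.
Unset Strict Implicit.
Unset Printing Implicit Defensive.

Import GRing.Theory.
Local Open Scope ring_scope.

Definition alternating_bilinear (F : fieldType) (V U : lmodType F)
    (b : V -> V -> U) : Prop :=
  [/\ forall v, linear (b^~ v), forall u, linear (b u) & forall u, b u u = 0].

(* [W], together with [w u v] read as the wedge product of [u] and [v], is the
   exterior square of [V].  This is its universal property, which determines
   [(W, w)] up to a unique isomorphism; see [exterior_square_exists]. *)
Definition is_exterior_square (F : fieldType) (V W : lmodType F)
    (w : V -> V -> W) : Prop :=
  alternating_bilinear w /\
  forall (U : lmodType F) (b : V -> V -> U), alternating_bilinear b ->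
    exists f : W -> U,
      [/\ linear f, forall u v, f (w u v) = b u v
        & forall g : W -> U,
            linear g -> (forall u v, g (w u v) = b u v) -> g =1 f].

(* Elements of the projective space on [U] are the [X : {vspace U}], with
   incidence [<=]; dimensions are vector dimensions throughout. *)
Definition pline (F : fieldType) (V : vectType F) :=
  {M : {vspace V} | \dim M == 2%N}.

Section Pluecker.

Context (F : fieldType) (V W : vectType F) (w : V -> V -> W).

(* Does not depend on the basis of [M]: see [plucker_basis]. *)
Definition plucker (M : pline V) : {vspace W} :=
  <[w (vbasis (val M))`_0 (vbasis (val M))`_1]>%VS.

Definition klein_quadric (P : {vspace W}) : Prop :=
  exists M : pline V, P = plucker M.

Definition parallel (C : {vspace W}) (M N : pline V) : Prop :=
  (C + plucker M = C + plucker N)%VS.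

Definition is_spread (S : pline V -> Prop) : Prop :=
  forall P : {vspace V}, \dim P = 1%N ->
    exists! M : pline V, S M /\ (P <= val M)%VS.

Definition parallel_class (R : pline V -> pline V -> Prop)
    (S : pline V -> Prop) : Prop :=
  exists M, forall N, S N <-> R M N.

Definition is_parallelism (R : pline V -> pline V -> Prop) : Prop :=
  Equivalence R /\ forall S, parallel_class R S -> is_spread S.

End Pluecker.

(* An ovoid (in the sense of Tits) of the projective space on the solid [T]:
   a nonempty set [O] of points of [T], no three of them collinear, such that
   at each [P] in [O] the tangents, i.e. the lines of [T] that meet [O] in [P]
   only, are precisely the lines through [P] in some plane [E]. *)
Definition is_ovoid (F : fieldType) (W : vectType F) (T : {vspace W})
    (O : {vspace W} -> Prop) : Prop :=
  [/\ exists P, O P,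
      forall P, O P -> \dim P = 1%N /\ (P <= T)%VS,
      forall L, \dim L = 2%N -> (L <= T)%VS ->
        forall P1 P2 P3, O P1 -> O P2 -> O P3 ->
          (P1 <= L)%VS -> (P2 <= L)%VS -> (P3 <= L)%VS ->
          [\/ P1 = P2, P1 = P3 | P2 = P3]
    & forall P, O P ->
        exists E : {vspace W},
          [/\ \dim E = 3%N, (P <= E)%VS, (E <= T)%VS
            & forall L, \dim L = 2%N -> (L <= T)%VS -> (P <= L)%VS ->
                (forall P', O P' -> (P' <= L)%VS -> P' = P) <-> (L <= E)%VS]].

Section Regular.

Context (F : fieldType) (V W : vectType F) (w : V -> V -> W).

(* A quadric of a solid is elliptic when its points form an ovoid. *)
Definition elliptic_section (T : {vspace W}) : Prop :=
  is_ovoid T (fun P => klein_quadric w P /\ (P <= T)%VS).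

Definition elliptic_linear_congruence (S : pline V -> Prop) : Prop :=
  exists T : {vspace W},
    [/\ \dim T = 4%N, elliptic_section T
      & forall X, S X <-> (plucker w X <= T)%VS].

Definition is_regular_spread (S : pline V -> Prop) : Prop :=
  is_spread S /\ elliptic_linear_congruence S.

End Regular.

Lemma alternating_wedge2 (F : fieldType) (V U : lmodType F) (w : V -> V -> U) :
  alternating_bilinear w -> forall x y a b c d,
  w (a *: x + b *: y) (c *: x + d *: y) = (a * d - b * c) *: w x y.
Proof.
case=> wl wr wa x y a b c d.
have w0r u : w u 0 = 0.
  by have := wr u (-1) 0 0; rewrite scaler0 addr0 scaleN1r addNr.
have w0l u : w 0 u = 0.
  by have := wl u (-1) 0 0; rewrite scaler0 addr0 scaleN1r addNr.
have wZr k u v : w u (k *: v) = k *: w u v.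
  by have := wr u k v 0; rewrite addr0 w0r addr0.
have wZl k u v : w (k *: u) v = k *: w u v.
  by have := wl v k u 0; rewrite addr0 w0l addr0.
have wN : w y x = - w x y.
  have := wa (1 *: x + y); rewrite (wl _ 1) !(wr _ 1) !wa !scale1r.
  by rewrite ?scaler0 ?add0r ?addr0 => /eqP; rewrite addrC addr_eq0 => /eqP.
rewrite wl wr wZr wa scaler0 add0r wZl wr wZr wa scaler0 addr0 wN.
by rewrite !scalerN scalerBl !scalerA.
Qed.

Lemma plucker_basis (F : fieldType) (V W : vectType F) (w : V -> V -> W)
    (M : pline V) (u v : V) :
  is_exterior_square w -> basis_of (val M) [:: u; v] ->
  plucker w M = <[w u v]>%VS.
Proof.
case=> walt _ buv.
have sub (x y u' v' : V) : basis_of (val M) [:: x; y] ->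
    u' \in val M -> v' \in val M -> (<[w u' v']> <= <[w x y]>)%VS.
  move=> bxy; rewrite -(span_basis bxy) span_cons span_seq1.
  move=> /memv_addP[_ /vlineP[a ->] [_ /vlineP[b ->] ->]].
  move=> /memv_addP[_ /vlineP[c ->] [_ /vlineP[d ->] ->]].
  rewrite (alternating_wedge2 walt) -memvE; apply: memvZ; exact: memv_line.
have bM : basis_of (val M) [:: (vbasis (val M))`_0; (vbasis (val M))`_1].
  have := vbasisP (val M).
  have : size (vbasis (val M)) = 2%N by rewrite size_tuple (eqP (valP M)).
  by case: (tval _) => [|x [|y [|? ?]]].
have mM (X : seq V) x : basis_of (val M) X -> x \in X -> x \in val M.
  exact: basis_mem.
apply/eqP; rewrite eqEsubv /plucker; apply/andP; split.
  by apply: sub => //; apply: (mM _ _ bM); rewrite !inE eqxx ?orbT.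
by apply: sub => //; apply: (mM _ _ buv); rewrite !inE eqxx ?orbT.
Qed.

Lemma exterior_square_exists (F : fieldType) (V : vectType F) :
  exists (W : vectType F) (w : V -> V -> W), is_exterior_square w.
Proof.
set n := \dim {:V}; pose c (i : 'I_n) (v : V) := coord (vbasis {:V}) i v.
pose e (i : 'I_n) : V := (vbasis {:V})`_i.
have cE v : v = \sum_i c i v *: e i.
  exact: (coord_basis (vbasisP {:V}) (memvf v)).
have cL i a u v : c i (a *: u + v) = a * c i u + c i v by rewrite /c linearP.
pose A u v : 'M[F]_n := \matrix_(i, j) (c i u * c j v - c j u * c i v).
have Al v : linear (A^~ v).
  by move=> a x y; apply/matrixP => i j; rewrite !mxE !cL /=; ring.
have Ar u : linear (A u).
  by move=> a x y; apply/matrixP => i j; rewrite !mxE !cL /=; ring.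
have Aa u : A u u = 0 by apply/matrixP => i j; rewrite !mxE mulrC subrr.
have sum2 (U : lmodType F) (b : V -> V -> U) : alternating_bilinear b ->
    forall u v, b u v = \sum_i \sum_j (c i u * c j v) *: b (e i) (e j).
  case=> bl br _ u v.
  pose bL x : {linear V -> U} :=
    HB.pack (b x) (GRing.isLinear.Build F V U *:%R (b x) (br x)).
  pose bR x : {linear V -> U} :=
    HB.pack (b^~ x) (GRing.isLinear.Build F V U *:%R (b^~ x) (bl x)).
  rewrite {1}(cE u) -[b _ v]/(bR v _) linear_sum; apply: eq_bigr => i _.
  rewrite linearZ /= {1}(cE v) -[b _ (\sum__ _)]/(bL (e i) _) linear_sum.
  by rewrite scaler_sumr; apply: eq_bigr => j _; rewrite linearZ /= scalerA.
have Aalt : alternating_bilinear A by split.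
pose X := [seq A p.1 p.2 | p <- [seq (e i, e j) | i <- enum 'I_n, j <- enum 'I_n]].
have AX u v : A u v \in <<X>>%VS.
  rewrite (sum2 _ _ Aalt); apply: memv_suml => i _; apply: memv_suml => j _.
  apply: memvZ; apply: memv_span; apply/mapP; exists (e i, e j) => //.
  by apply/allpairsP; exists (i, j); rewrite !mem_enum.
pose w u v := vsproj <<X>>%VS (A u v).
exists (subvs_of <<X>>%VS), w; split.
  split=> [v a x y|u a x y|u]; rewrite /w.
  - by rewrite -linearP; congr (vsproj _ _); apply: Al.
  - by rewrite -linearP; congr (vsproj _ _); apply: Ar.
  - by rewrite Aa linear0.
move=> U b balt; case: (balt) => bl br ba.
have bN i j : b (e j) (e i) = - b (e i) (e j).
  have := alternating_wedge2 balt (e i) (e j) 0 1 1 0.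
  by rewrite !scale0r !scale1r add0r addr0 mul0r mulr1 sub0r scaleN1r.
pose f (x : subvs_of <<X>>%VS) : U :=
  \sum_(i < n) \sum_(j < n | (i < j)%N) (vsval x i j) *: b (e i) (e j).
have fL : linear f.
  move=> a x y; rewrite /f scaler_sumr -big_split; apply: eq_bigr => i _ /=.
  rewrite scaler_sumr -big_split; apply: eq_bigr => j _ /=.
  by rewrite !mxE scalerDl scalerA.
have fw u v : f (w u v) = b u v.
  pose G i j := (c i u * c j v) *: b (e i) (e j).
  have -> : f (w u v) = \sum_(i < n) \sum_(j < n | (i < j)%N) (G i j + G j i).
    apply: eq_bigr => i _; apply: eq_bigr => j _.
    by rewrite vsprojK // mxE /G (bN i j) scalerN scalerBl.
  rewrite (sum2 _ _ balt) -/G.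
  under eq_bigr do rewrite big_split.
  rewrite big_split /= [X in _ + X](exchange_big_dep xpredT) //= -big_split /=.
  apply: eq_bigr => i _.
  rewrite [RHS](bigID (fun j : 'I_n => (i < j)%N)) /=; congr (_ + _).
  rewrite [RHS](bigD1 i) ?ltnn //= ba scaler0 add0r.
  apply: eq_bigl => j; rewrite -leqNgt ltn_neqAle andbC.
  by congr (_ && _).
exists f; split=> // g gL gw x.
pose g' : {linear subvs_of <<X>>%VS -> U} :=
  HB.pack g (GRing.isLinear.Build F _ U *:%R g gL).
pose f' : {linear subvs_of <<X>>%VS -> U} :=
  HB.pack f (GRing.isLinear.Build F _ U *:%R f fL).
have xE : x = \sum_(i < size X) coord (in_tuple X) i (vsval x) *: vsproj _ X`_i.
  rewrite -{1}(vsvalK x) {1}(@coord_span _ _ _ (in_tuple X) _ (subvsP x)).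
  by rewrite linear_sum; apply: eq_bigr => i _; rewrite linearZ.
rewrite xE -[g _]/(g' _) -[f _]/(f' _) !linear_sum; apply: eq_bigr => i _.
rewrite !linearZ /=; congr (_ *: _).
have /mapP[[u v] _ ->] : X`_i \in X by apply: mem_nth.
by rewrite -/(w u v) gw fw.
Qed.

(* Main.v *)
Require Import Defs.
From mathcomp Require Import all_boot all_order all_algebra.
From HB Require Import structures.
From mathcomp Require Import ring.

Set Implicit Arguments.
Unset Strict Implicit.
Unset Printing Implicit Defensive.

Import GRing.Theory.
Local Open Scope ring_scope.

(** Every line through the point spanned by [p] is sent by the Pluecker embedding
    to a point [<[w p v]>], and the vectors [w p v], for [v] in [V], form a
    subspace [D] of [W] of dimension at least 3 in which all vectors are
    decomposable.  As [C] has no point on the Klein quadric, [D] meets [C] in 0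
    only.  Let [T] be a solid through [C].  Since [\dim W <= 6], [D] meets [T];
    since [C] is a hyperplane of [T], it does so in a single point.  This point
    is the image of the only line through [<[p]>] whose image lies in [T], so
    the lines with image in [T] form a spread ([solid_spread]).  The parallel
    class of [M] consists of the lines with image in the solid
    [C + plucker w M] ([parallelE]), which settles the parallelism.

    For regularity it remains to see that [T] meets the Klein quadric in an
    ovoid.  A basis of [V] gives Pluecker coordinates on [W], that is, an
    alternating 4x4 matrix [f x] for each [x] in [W], and [x] is decomposable
    exactly when the Pfaffian of [f x] vanishes ([pfaffian_wedge],
    [pfaffian_eq0_wedge]).  The Pfaffian is a quadratic form, so a line carrying
    two singular points that are orthogonal for the polar form is totally
    singular.  No line of [T] is so, because it meets the hyperplane [C]
    ([secant_polar_neq0]).  Therefore a line of [T] has at most two singular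
    points ([collinear_points]), and the tangents at a singular point [<[p]>] of
    [T] are the lines through [<[p]>] in the intersection of [T] with the
    hyperplane orthogonal to [p] ([tangent_plane]).  That this intersection is a
    plane, rather than all of [T], follows again from the spread property: it
    provides a line skew to the one represented by [p] and with image in [T]
    ([skew_line]), and the images of skew lines are not orthogonal. *)

(** * Alternating bilinear maps *)

Section Wedge.

Context (F : fieldType) (V W : vectType F) (w : V -> V -> W).
Context (walt : alternating_bilinear w).

(** Packaging [w u] as a linear map gives access to its image and kernel as
    subspaces. *)
Definition wedge_hom (u : V) : 'Hom(V, W) :=
  let: And3 _ wr _ := walt in
  linfun (HB.pack (w u) (GRing.isLinear.Build F V W *:%R (w u) (wr u))
          : {linear V -> W}).

Lemma wedge_homE u v : wedge_hom u v = w u v.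
Proof. by rewrite /wedge_hom; case: walt => ? ? ?; rewrite lfunE. Qed.

Lemma wedgeC u v : w v u = - w u v.
Proof.
have := alternating_wedge2 walt u v 0 1 1 0.
by rewrite !scale0r !scale1r add0r addr0 mul0r mulr1 sub0r scaleN1r.
Qed.

Lemma wedgeZr k u v : w u (k *: v) = k *: w u v.
Proof. by rewrite -!wedge_homE linearZ. Qed.

Lemma wedgeBr u v v' : w u (v - v') = w u v - w u v'.
Proof. by rewrite -!wedge_homE linearB. Qed.

Lemma wedgeZl k u v : w (k *: u) v = k *: w u v.
Proof. by rewrite wedgeC wedgeZr -scalerN -wedgeC. Qed.

Lemma wedge0l v : w 0 v = 0.
Proof. by rewrite -(scale0r 0) wedgeZl scale0r. Qed.

(** Pairing the terms [(i, j)] and [(j, i)] of the full bilinear expansion leaves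
    the 2x2 minors of the coordinates as coefficients. *)
Lemma wedge_expand2 n (e : n.-tuple V) (a b : 'I_n -> F) :
  w (\sum_(i < n) a i *: e`_i) (\sum_(j < n) b j *: e`_j) =
  \sum_(i < n) \sum_(j < n | (i < j)%N) (a i * b j - a j * b i) *: w e`_i e`_j.
Proof.
case: (walt) => _ _ ww.
pose G (i j : 'I_n) := (a i * b j) *: w e`_i e`_j.
have -> : w (\sum_(i < n) a i *: e`_i) (\sum_(j < n) b j *: e`_j) =
    \sum_(i < n) \sum_(j < n) G i j.
  rewrite wedgeC -wedge_homE linear_sum -sumrN; apply: eq_bigr => i _.
  rewrite linearZ /= wedge_homE -scalerN -wedgeC -wedge_homE linear_sum.
  rewrite scaler_sumr; apply: eq_bigr => j _.
  by rewrite linearZ /= wedge_homE scalerA.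
have -> : \sum_(i < n) \sum_(j < n | (i < j)%N)
    (a i * b j - a j * b i) *: w e`_i e`_j =
    \sum_(i < n) \sum_(j < n | (i < j)%N) (G i j + G j i).
  apply: eq_bigr => i _; apply: eq_bigr => j _.
  by rewrite /G (wedgeC e`_i) scalerN scalerBl.
under [RHS]eq_bigr do rewrite big_split.
rewrite [RHS]big_split /= [X in _ + X](exchange_big_dep xpredT) //=.
rewrite -big_split /=; apply: eq_bigr => i _.
rewrite (bigID (fun j : 'I_n => (i < j)%N)) /=; congr (_ + _).
rewrite (bigD1 i) ?ltnn //= /G ww scaler0 add0r.
apply: eq_bigl => j; rewrite -leqNgt ltn_neqAle andbC.
by congr (_ && _).
Qed.

End Wedge.

(** * The Pfaffian of a 4x4 alternating matrix *)

Local Notation o0 := (@Ordinal 4 0 isT).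
Local Notation o1 := (@Ordinal 4 1 isT).
Local Notation o2 := (@Ordinal 4 2 isT).
Local Notation o3 := (@Ordinal 4 3 isT).

Section Pfaffian.

Context (F : fieldType).
Implicit Types A B : 'M[F]_4.

Definition pfaffian A : F :=
  A o0 o1 * A o2 o3 - A o0 o2 * A o1 o3 + A o0 o3 * A o1 o2.

Definition pfaffian_polar A B : F :=
  A o0 o1 * B o2 o3 - A o0 o2 * B o1 o3 + A o0 o3 * B o1 o2
  + (B o0 o1 * A o2 o3 - B o0 o2 * A o1 o3 + B o0 o3 * A o1 o2).

Lemma pfaffian_comb a b A B :
  pfaffian (a *: A + b *: B) =
  a ^+ 2 * pfaffian A + a * b * pfaffian_polar A B + b ^+ 2 * pfaffian B.
Proof. rewrite /pfaffian /pfaffian_polar !mxE; ring. Qed.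

Lemma ord4P (P : 'I_4 -> Prop) : P o0 -> P o1 -> P o2 -> P o3 -> forall i, P i.
Proof.
move=> p0 p1 p2 p3 [[|[|[|[|m]]]] //] lti.
- by rewrite (_ : Ordinal lti = o0) //; apply: val_inj.
- by rewrite (_ : Ordinal lti = o1) //; apply: val_inj.
- by rewrite (_ : Ordinal lti = o2) //; apply: val_inj.
- by rewrite (_ : Ordinal lti = o3) //; apply: val_inj.
Qed.

(** An alternating matrix with zero Pfaffian has rank at most 2.  In the form
    below this says that its rows [i] and [j] have the wedge product
    [A i j *: A], up to the identification of alternating matrices with
    bivectors.  The difference of the two sides is alternating in [i, j, k, l],
    hence is 0 or, up to sign, the Pfaffian. *)
Lemma pfaffian_minors A : (forall i, A i i = 0) ->
    (forall i j, A j i = - A i j) -> pfaffian A = 0 ->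
  forall i j k l, A i k * A j l - A i l * A j k = A i j * A k l.
Proof.
move=> A0 AN pfA.
(* The form in which [ring] can use the hypothesis: a monomial on the left. *)
have mon : A o0 o1 * A o2 o3 = A o0 o2 * A o1 o3 - A o0 o3 * A o1 o2.
  by apply/eqP; rewrite -subr_eq0 -pfA /pfaffian; apply/eqP; ring.
have A10 := AN o0 o1; have A20 := AN o0 o2; have A30 := AN o0 o3.
have A21 := AN o1 o2; have A31 := AN o1 o3; have A32 := AN o2 o3.
have AE := (A10, A20, A30, A21, A31, A32, A0).
by elim/ord4P; elim/ord4P; elim/ord4P; elim/ord4P; rewrite ?AE;
  (ring || ring: mon).
Qed.

End Pfaffian.

(** * Pluecker coordinates *)

Section Coordinates.

Context (F : fieldType) (V W : vectType F) (w : V -> V -> W).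
Context (ext2 : is_exterior_square w).
Let walt : alternating_bilinear w := ext2.1.

Section Basis.

Context (e : 4.-tuple V) (eB : basis_of {:V} e).

Definition plucker_coordinates (f : 'Hom(W, 'M[F]_4)) : Prop :=
  forall u v i j,
    f (w u v) i j = coord e i u * coord e j v - coord e j u * coord e i v.

Lemma plucker_coordinates_exist : exists f, plucker_coordinates f.
Proof.
pose b u v : 'M[F]_4 :=
  \matrix_(i, j) (coord e i u * coord e j v - coord e j u * coord e i v).
have [|g [gL gw _]] := ext2.2 _ b.
  split=> [v a x y|u a x y|u]; apply/matrixP => i j; rewrite !mxE ?linearP /=.
  - ring.
  - ring.
  - by rewrite mulrC subrr.
exists (linfun (HB.pack g (GRing.isLinear.Build F W 'M[F]_4 *:%R g gL)
                : {linear W -> 'M[F]_4})).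
by move=> u v i j; rewrite lfunE /= gw mxE.
Qed.

Context (f : 'Hom(W, 'M[F]_4)) (fw : plucker_coordinates f).

(** Both sides are linear in [x] and agree when [x] is of the form [w u v], so the
    uniqueness in the universal property applies.  Consequently [W] is spanned by
    six vectors and [f] is injective. *)
Lemma plucker_coordinates_sum x :
  x = \sum_(i < 4) \sum_(j < 4 | (i < j)%N) f x i j *: w e`_i e`_j.
Proof.
have [h [_ _ hU]] := ext2.2 _ _ walt.
have idL : linear (@id W) by [].
rewrite {1}[x](hU _ idL) //; symmetry.
apply: (hU (fun x => \sum_(i < 4) \sum_(j < 4 | (i < j)%N)
                       f x i j *: w e`_i e`_j)) => [a y z|u v].
  rewrite scaler_sumr -big_split; apply: eq_bigr => i _ /=.
  rewrite scaler_sumr -big_split; apply: eq_bigr => j _ /=.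
  by rewrite linearP !mxE scalerDl scalerA.
rewrite [in RHS](coord_basis eB (memvf u)) [in RHS](coord_basis eB (memvf v)).
rewrite wedge_expand2 //; apply: eq_bigr => i _; apply: eq_bigr => j _.
by rewrite fw.
Qed.

Lemma plucker_coordinates_inj x y : f x = f y -> x = y.
Proof.
by move=> fxy; rewrite (plucker_coordinates_sum x) fxy -plucker_coordinates_sum.
Qed.

Lemma plucker_coordinatesN x i j : f x j i = - f x i j.
Proof.
rewrite (plucker_coordinates_sum x) !linear_sum !summxE -sumrN.
apply: eq_bigr => k _; rewrite !linear_sum !summxE -sumrN.
by apply: eq_bigr => l _; rewrite !linearZ !mxE !fw; ring.
Qed.

Lemma plucker_coordinates_diag x i : f x i i = 0.
Proof.
rewrite (plucker_coordinates_sum x) !linear_sum !summxE big1 // => k _.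
rewrite !linear_sum !summxE big1 // => l _.
by rewrite !linearZ !mxE !fw; ring.
Qed.

Lemma dim_exterior_square_le : (\dim {:W} <= 6)%N.
Proof.
pose X := [:: w e`_0 e`_1; w e`_0 e`_2; w e`_0 e`_3;
              w e`_1 e`_2; w e`_1 e`_3; w e`_2 e`_3].
apply: leq_trans (dim_span X); apply: dimvS; apply/subvP => x _.
rewrite (plucker_coordinates_sum x); apply: memv_suml => i _.
apply: memv_suml => j ltij; apply: memvZ; apply: memv_span.
by move: i j ltij; elim/ord4P; elim/ord4P => // _; rewrite !inE eqxx ?orbT.
Qed.

(** If [coord e i u] is nonzero, the vanishing of the coordinates [(i, j)] of
    [w u v] shows that [v] is the multiple of [u] by
    [coord e i v / coord e i u]. *)
Lemma wedge_eq0 u v : u != 0 -> w u v = 0 -> v \in <[u]>%VS.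
Proof.
move=> u0 wuv0.
have [i ci0] : exists i, coord e i u != 0.
  apply/existsP; apply: contraR u0 => /existsPn c0.
  rewrite (coord_basis eB (memvf u)) big1 // => i _.
  by rewrite (eqP (negPn (c0 i))) scale0r.
apply/vlineP; exists (coord e i v / coord e i u).
rewrite {1}(coord_basis eB (memvf v)) {2}(coord_basis eB (memvf u)).
rewrite scaler_sumr; apply: eq_bigr => j _; rewrite scalerA; congr (_ *: _).
have /esym := fw u v i j; rewrite wuv0 linear0 mxE => /eqP.
by rewrite subr_eq0 => /eqP uv; apply: (mulfI ci0); rewrite uv; field.
Qed.

Lemma pfaffian_wedge u v : pfaffian (f (w u v)) = 0.
Proof. by rewrite /pfaffian !fw; ring. Qed.

(** If [f x i j] is nonzero, the line represented by [x] is spanned by the rows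
    [i] and [j] of the matrix [f x]. *)
Lemma pfaffian_eq0_wedge x : pfaffian (f x) = 0 -> exists u v, x = w u v.
Proof.
have [-> _|x0 pfx] := eqVneq x 0.
  by exists 0, 0; rewrite -(wedge_homE walt) linear0.
have [i [j fij0]] : exists i j, f x i j != 0.
  have fx0 : f x != 0 by apply: contra_neq x0 => fx0;
    apply: plucker_coordinates_inj; rewrite fx0 linear0.
  exact/matrix0Pn.
pose r k : V := \sum_(l < 4) f x k l *: e`_l.
have cr k l : coord e l (r k) = f x k l.
  rewrite /r coord_sum_free //; exact: basis_free eB.
suff E : f x i j *: x = w (r i) (r j).
  exists ((f x i j)^-1 *: r i), (r j).
  by rewrite (wedgeZl walt) -E scalerA mulVf // scale1r.
apply: plucker_coordinates_inj; apply/matrixP => k l.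
rewrite linearZ mxE fw !cr.
have := pfaffian_minors (plucker_coordinates_diag x)
         (plucker_coordinatesN x) pfx i j k l => <-.
by rewrite [_ * f x j k]mulrC [f x j k * _]mulrC.
Qed.

End Basis.
End Coordinates.

(** * Points and lines *)

Section Lines.

Context (F : fieldType) (V : vectType F).

Lemma free2 (u v : V) : free [:: u; v] = (u != 0) && (v \notin <[u]>%VS).
Proof.
have -> : free [:: u; v] = free [:: v; u].
  by apply: perm_free; apply/permPl; apply: (perm_catC [:: u] [:: v]).
by rewrite free_cons span_seq1 seq1_free andbC.
Qed.

Lemma line_basis (L : {vspace V}) u v : \dim L = 2%N -> u != 0 ->
  v \notin <[u]>%VS -> u \in L -> v \in L -> basis_of L [:: u; v].
Proof.
move=> dimL u0 vu uL vL; rewrite basisEfree free2 u0 vu /= dimL leqnn andbT.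
by apply/span_subvP => x; rewrite !inE => /orP[] /eqP->.
Qed.

Lemma pline_through (u v : V) : u != 0 -> v \notin <[u]>%VS ->
  exists M : pline V, basis_of (val M) [:: u; v].
Proof.
move=> u0 vu; have dimM : \dim <<[:: u; v]>> == 2%N.
  by rewrite -[_ == _]/(free [:: u; v]) free2 u0.
by exists (exist _ <<[:: u; v]>>%VS dimM); rewrite /basis_of eqxx free2 u0.
Qed.

Lemma line_basis_at (L : {vspace V}) u : \dim L = 2%N -> u != 0 -> u \in L ->
  exists v, basis_of L [:: u; v].
Proof.
move=> dimL u0 uL; have : ~~ (L <= <[u]>)%VS.
  by apply/negP => /dimvS; rewrite dimL dim_vline u0.
by case/subvPn => v vL vu; exists v; apply: line_basis.
Qed.

Lemma pline_basis (M : pline V) : exists u v, basis_of (val M) [:: u; v].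
Proof.
have u0 : vpick (val M) != 0 by rewrite vpick0 -dimv_eq0 (eqP (valP M)).
have [v bM] := line_basis_at (eqP (valP M)) u0 (memv_pick _).
by exists (vpick (val M)), v.
Qed.

Lemma point_vector (U : vectType F) (P : {vspace U}) : \dim P = 1%N ->
  exists2 u, u != 0 & P = <[u]>%VS.
Proof.
move=> dimP; have u0 : vpick P != 0 by rewrite vpick0 -dimv_eq0 dimP.
exists (vpick P) => //; apply/eqP; rewrite eq_sym eqEdim dim_vline u0 dimP andbT.
by rewrite -memvE memv_pick.
Qed.

Lemma vline_eq (U : vectType F) (x y : U) :
  y != 0 -> y \in <[x]>%VS -> <[x]>%VS = <[y]>%VS.
Proof.
move=> y0 yx; apply/eqP; rewrite eq_sym eqEdim -memvE yx !dim_vline y0.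
by case: (x != 0).
Qed.

End Lines.

(** * The Klein quadric *)

Section KleinQuadric.

Context (F : fieldType) (V W : vectType F) (w : V -> V -> W).
Context (dimV : \dim {:V}%VS = 4%N) (ext2 : is_exterior_square w).
Let walt : alternating_bilinear w := ext2.1.

Lemma basis4_exists : exists e : 4.-tuple V, basis_of {:V} e.
Proof. by exists (tcast dimV (vbasis {:V})); rewrite val_tcast vbasisP. Qed.

Lemma wedge_neq0 u v : free [:: u; v] -> w u v != 0.
Proof.
rewrite free2 => /andP[u0 vu]; apply: contra vu => /eqP wuv0.
have [e eB] := basis4_exists; have [f fw] := plucker_coordinates_exist ext2 e.
exact: (wedge_eq0 eB fw).
Qed.

Lemma wedge_neq0_free u v : w u v != 0 -> u != 0 /\ v \notin <[u]>%VS.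
Proof.
have [_ _ ww] := walt.
move=> wuv; split; first by apply: contra_neq wuv => ->; rewrite wedge0l.
apply: contra wuv => /vlineP [k ->].
by rewrite (wedgeZr walt) ww scaler0.
Qed.

Lemma klein_quadric_wedge u v : w u v != 0 -> klein_quadric w <[w u v]>%VS.
Proof.
case/wedge_neq0_free => u0 vu; have [M bM] := pline_through u0 vu.
by exists M; rewrite (plucker_basis ext2 bM).
Qed.

Lemma klein_quadric_vector P : klein_quadric w P ->
  exists u v, w u v != 0 /\ P = <[w u v]>%VS.
Proof.
case=> M ->; have [u [v bM]] := pline_basis M.
exists u, v; rewrite (plucker_basis ext2 bM); split=> //.
exact: wedge_neq0 (basis_free bM).
Qed.

Lemma klein_quadric_dim P : klein_quadric w P -> \dim P = 1%N.
Proof. by case/klein_quadric_vector => u [v [n0 ->]]; rewrite dim_vline n0. Qed.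

(** The kernel of [w p] is spanned by [p]; the lines through [<[p]>] thus form a
    plane on the Klein quadric. *)
Lemma dim_wedge_image p : p != 0 -> (3 <= \dim (wedge_hom walt p @: {:V}))%N.
Proof.
move=> p0; have := limg_ker_dim (wedge_hom walt p) {:V}.
have : (\dim (fullv :&: lker (wedge_hom walt p)) <= 1)%N.
  apply: (@leq_trans (\dim <[p]>)); last by rewrite dim_vline p0.
  apply: dimvS.
  apply/subvP => v /memv_capP[_]; rewrite memv_ker wedge_homE => /eqP wpv0.
  have [e eB] := basis4_exists.
  have [f fw] := plucker_coordinates_exist ext2 e.
  exact: (wedge_eq0 eB fw).
rewrite dimV => ker1 dim4.
rewrite -(leq_add2l (\dim (fullv :&: lker (wedge_hom walt p)))) dim4.
by rewrite (leq_add2r 3 _ 1).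
Qed.

(** * Solids through a plane external to the Klein quadric *)

Section External.

Context (C : {vspace W}) (dimC : \dim C = 3%N).
Context (C_external : forall P : {vspace W},
          \dim P = 1%N -> (P <= C)%VS -> ~ klein_quadric w P).

Lemma external_wedge u v : w u v \in C -> w u v = 0.
Proof.
move=> wC; apply/eqP; apply: contraT => n0.
case: (@C_external <[w u v]>%VS); rewrite ?dim_vline ?n0 //.
exact: klein_quadric_wedge.
Qed.

Lemma plucker_external (M : pline V) : ~~ (plucker w M <= C)%VS.
Proof.
apply/negP => sub; apply: C_external sub _; last by exists M.
by apply: klein_quadric_dim; exists M.
Qed.

Section Solid.

Context (T : {vspace W}) (dimT : \dim T = 4%N) (CT : (C <= T)%VS).

Lemma solid_span x : x \in T -> x \notin C -> T = (C + <[x]>)%VS.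
Proof.
move=> xT xC; apply/eqP; rewrite eq_sym eqEdim subv_add CT -memvE xT dimT -dimC.
rewrite (ltn_leqif (dimv_leqif_sup (addvSl C <[x]>%VS))).
by rewrite subv_add subvv -memvE xC.
Qed.

(** As [C] is a hyperplane of [T], it meets the line through [<[x]>] and [<[y]>];
    the form below also covers the case that these points coincide. *)
Lemma solid_project x y : x \in T -> x \notin C -> y \in T ->
  exists k, y - k *: x \in C.
Proof.
move=> xT xC; rewrite (solid_span xT xC).
by case/memv_addP => c cC [_ /vlineP[k ->] ->]; exists k; rewrite addrK.
Qed.

(** Existence: the plane of [dim_wedge_image] meets [T] because of
    [3 + 4 > 6].  Uniqueness: if [w p v] and [w p v'] are in [T], then some
    [w p (v' - k *: v)] is in [C] and therefore vanishes, which puts [v'] on the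
    line spanned by [p] and [v]. *)
Lemma solid_spread : is_spread (fun M : pline V => (plucker w M <= T)%VS).
Proof.
move=> P /point_vector[p p0 ->]; pose D := (wedge_hom walt p @: {:V})%VS.
have [x [x0 xD xT]] : exists x, [/\ x != 0, x \in D & x \in T].
  have DT0 : (D :&: T)%VS != 0%VS.
    have [e eB] := basis4_exists.
    have [f fw] := plucker_coordinates_exist ext2 e.
    rewrite -dimv_eq0; apply/eqP => dim0.
    have := dimv_sum_cap D T; rewrite dim0 addn0 dimT => dimDT.
    have := leq_trans (dimvS (subvf (D + T)%VS))
                      (dim_exterior_square_le ext2 eB fw).
    by rewrite dimDT leqNgt (leq_add (dim_wedge_image p0) (leqnn 4)).
  exists (vpick (D :&: T)%VS); rewrite vpick0 DT0.
  by have /memv_capP[] := memv_pick (D :&: T)%VS.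
case/memv_imgP: xD => v _ xE; rewrite wedge_homE in xE; subst x.
have [_ vp] := wedge_neq0_free x0; have [M bM] := pline_through p0 vp.
have wT y : (<[y]> <= T)%VS = (y \in T) by rewrite memvE.
exists M; split.
  by rewrite (plucker_basis ext2 bM) wT -memvE (basis_mem bM) ?mem_head.
move=> N [NT]; rewrite -memvE => pN.
have [v' bN] := line_basis_at (eqP (valP N)) p0 pN.
move: NT; rewrite (plucker_basis ext2 bN) wT => v'T.
have xC : w p v \notin C by apply: contra x0 => /external_wedge ->.
have [k] := solid_project xT xC v'T.
have -> : w p v' - k *: w p v = w p (v' - k *: v).
  by rewrite (wedgeBr walt) (wedgeZr walt).
move/external_wedge => wk0.
have v'k : v' - k *: v \in <[p]>%VS.
  apply: contraT => nk; have := wedge_neq0 (u := p) (v := v' - k *: v).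
  by rewrite free2 p0 nk wk0 eqxx => /(_ isT).
have [pM vM] : p \in val M /\ v \in val M.
  by split; apply: (basis_mem bM); rewrite !inE eqxx ?orbT.
apply/val_inj/eqP; rewrite eq_sym eqEdim (eqP (valP M)) (eqP (valP N)).
rewrite leqnn andbT.
rewrite -(span_basis bN); apply/span_subvP => y.
rewrite !inE => /orP[] /eqP-> //.
rewrite -(subrK (k *: v) v') memvD ?memvZ //.
by case/vlineP: v'k => l ->; rewrite memvZ.
Qed.

Section Coordinates.

Context (e : 4.-tuple V) (eB : basis_of {:V} e).
Context (f : 'Hom(W, 'M[F]_4)) (fw : plucker_coordinates w e f).

Lemma klein_quadric_pfaffian x :
  x != 0 -> pfaffian (f x) = 0 -> klein_quadric w <[x]>%VS.
Proof.
move=> x0 /(pfaffian_eq0_wedge ext2 eB fw) [u [v xE]]; rewrite xE in x0 *.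
exact: klein_quadric_wedge.
Qed.

(** Otherwise all points of the line through [<[x]>] and [<[y]>] would be on the
    quadric, including the point in which it meets [C]. *)
Lemma secant_polar_neq0 x y : x \in T -> x \notin C -> y \in T ->
  pfaffian (f x) = 0 -> pfaffian (f y) = 0 ->
  pfaffian_polar (f x) (f y) = 0 -> y \in <[x]>%VS.
Proof.
move=> xT xC yT qx qy bxy; have [k zC] := solid_project xT xC yT.
have qz : pfaffian (f (y - k *: x)) = 0.
  rewrite -scaleNr -[y]scale1r addrC linearD !linearZ pfaffian_comb qx qy bxy.
  by ring.
have [u [v zE]] := pfaffian_eq0_wedge ext2 eB fw qz.
rewrite zE in zC; rewrite (external_wedge zC) in zE.
by move/eqP: zE; rewrite subr_eq0 => /eqP ->; rewrite memvZ ?memv_line.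
Qed.

(** On the line spanned by [x1] and [x2] the Pfaffian of [a *: x1 + b *: x2] is
    [a * b] times the polar form of [x1] and [x2], which is nonzero by
    [secant_polar_neq0]. *)
Lemma collinear_points L x1 x2 x3 : \dim L = 2%N -> (L <= T)%VS ->
  x1 \in L -> x2 \in L -> x3 \in L -> x1 \notin C ->
  x1 != 0 -> x2 != 0 -> x3 != 0 ->
  pfaffian (f x1) = 0 -> pfaffian (f x2) = 0 -> pfaffian (f x3) = 0 ->
  [\/ <[x1]> = <[x2]>, <[x1]> = <[x3]> | <[x2]> = <[x3]>]%VS.
Proof.
move=> dimL LT x1L x2L x3L x1C x10 x20 x30 q1 q2 q3.
have [x21|x21] := boolP (x2 \in <[x1]>%VS); first by apply/Or31/vline_eq.
have /span_basis Lspan := line_basis dimL x10 x21 x1L x2L.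
move: (x3L); rewrite -Lspan span_cons span_seq1.
case/memv_addP => _ /vlineP[a ->] [_ /vlineP[b ->] x3E].
have : a * b * pfaffian_polar (f x1) (f x2) = 0.
  by rewrite -q3 x3E linearD !linearZ pfaffian_comb q1 q2; ring.
move/eqP; rewrite !mulf_eq0 => /orP[/orP[] /eqP z0|/eqP b12].
- by apply/Or33/vline_eq; rewrite // x3E z0 scale0r add0r memvZ ?memv_line.
- by apply/Or32/vline_eq; rewrite // x3E z0 scale0r addr0 memvZ ?memv_line.
have [x1T x2T] := (subvP LT _ x1L, subvP LT _ x2L).
by rewrite (secant_polar_neq0 x1T x1C x2T) in x21.
Qed.

(** Let [y] complete [p] to a basis of a line through [<[p]>].  If [y] is not
    orthogonal to [p], solving a linear equation for [s] gives a second singular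
    point [s *: p + y]; if it is, a second singular point contradicts
    [secant_polar_neq0].  The vector [y0] ensures that the points orthogonal to
    [<[p]>] do not fill [T]. *)
Lemma tangent_plane p y0 : p \in T -> p \notin C -> pfaffian (f p) = 0 ->
  y0 \in T -> pfaffian_polar (f p) (f y0) != 0 ->
  exists E : {vspace W},
    [/\ \dim E = 3%N, (<[p]> <= E)%VS, (E <= T)%VS
      & forall L, \dim L = 2%N -> (L <= T)%VS -> (<[p]> <= L)%VS ->
          (forall P', klein_quadric w P' /\ (P' <= T)%VS -> (P' <= L)%VS ->
             P' = <[p]>%VS) <-> (L <= E)%VS].
Proof.
move=> pT pC qp y0T by0.
have p0 : p != 0 by apply: contraNneq pC => ->; rewrite mem0v.
pose b (y : W) : F^o := pfaffian_polar (f p) (f y).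
have bL : linear b.
  by move=> a x y; rewrite /b linearP /pfaffian_polar !mxE /GRing.scale /=; ring.
pose g : 'Hom(W, F^o) :=
  linfun (HB.pack b (GRing.isLinear.Build F W F^o *:%R b bL)
          : {linear W -> F^o}).
have gE y : g y = pfaffian_polar (f p) (f y) by rewrite lfunE.
have ET : (T :&: lker g <= T)%VS by exact: capvSl.
have gp : g p = 0.
  rewrite gE; have -> : pfaffian_polar (f p) (f p) = 2 * pfaffian (f p).
    by rewrite /pfaffian_polar /pfaffian; ring.
  by rewrite qp mulr0.
have pE : p \in (T :&: lker g)%VS by rewrite memv_cap pT memv_ker gp eqxx.
exists (T :&: lker g)%VS; split=> //.
  have := limg_ker_dim g T; rewrite dimT.
  suff -> : \dim (g @: T) = 1%N by rewrite addn1 => -[].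
  apply/eqP; rewrite eqn_leq; apply/andP; split.
    by apply: leq_trans (dimvS (subvf _)) _; rewrite dimvf.
  rewrite lt0n dimv_eq0; apply: contra by0 => /eqP g0.
  by have := memv_img g y0T; rewrite g0 memv0 gE.
move=> L dimL LT; rewrite -memvE => pL.
have [y bpy] := line_basis_at dimL p0 pL.
have /andP[_ yp] : (p != 0) && (y \notin <[p]>%VS).
  by rewrite -free2; apply: basis_free bpy.
have yL : y \in L by apply: (basis_mem bpy); rewrite !inE eqxx orbT.
have yT := subvP LT _ yL.
have qcomb a c : pfaffian (f (a *: p + c *: y)) =
    c * (a * g y + c * pfaffian (f y)).
  by rewrite linearD !linearZ pfaffian_comb qp gE; ring.
split=> [tang|LE].
  rewrite -(span_basis bpy); apply/span_subvP => x.
  rewrite !inE => /orP[] /eqP-> //; rewrite memv_cap yT memv_ker.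
  apply: contraT => gy0; pose z := (- (pfaffian (f y) / g y)) *: p + 1 *: y.
  have zp : z \notin <[p]>%VS.
    apply: contra yp => zp; rewrite -[y]scale1r.
    by rewrite -[_ *: y](addKr ((- (pfaffian (f y) / g y)) *: p)) memvD //
      ?memvN ?memvZ ?memv_line.
  have zL : z \in L by rewrite memvD ?memvZ.
  have z0 : z != 0 by apply: contraNneq zp => ->; rewrite mem0v.
  have qz : pfaffian (f z) = 0 by rewrite qcomb; field.
  have zQ : klein_quadric w <[z]>%VS /\ (<[z]> <= T)%VS.
    by split; [exact: klein_quadric_pfaffian | rewrite -memvE (subvP LT)].
  have zpE : <[z]>%VS = <[p]>%VS by apply: tang => //; rewrite -memvE.
  by rewrite -zpE memv_line in zp.
have gy : g y = 0.
  by apply/eqP; rewrite -memv_ker; have /memv_capP[] := subvP LE _ yL.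
move=> P' [QP' _]; have [u [v [z0 ->]]] := klein_quadric_vector QP'.
rewrite -memvE; set z := w u v => zL; apply/esym/vline_eq => //.
have := zL; rewrite -(span_basis bpy) span_cons span_seq1.
case/memv_addP => _ /vlineP[a ->] [_ /vlineP[c ->] zE].
have qz : pfaffian (f z) = 0 by exact: pfaffian_wedge fw u v.
move: qz; rewrite zE qcomb gy mulr0 add0r => /eqP; rewrite !mulf_eq0.
case: (eqVneq c 0) => [-> _|_ /= /eqP qy].
  by rewrite scale0r addr0 memvZ ?memv_line.
by rewrite (secant_polar_neq0 pT pC yT qp qy) // -?gE // in yp.
Qed.

End Coordinates.

(** Take any point off [M]: the line of the spread through it differs from [M],
    and distinct lines of a spread have no point in common. *)
Lemma skew_line (M : pline V) : (plucker w M <= T)%VS ->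
  exists M' : pline V, (plucker w M' <= T)%VS /\ (val M :&: val M')%VS = 0%VS.
Proof.
move=> MT; have : ~~ ({:V} <= val M)%VS.
  by apply/negP => /dimvS; rewrite (eqP (valP M)) dimV.
case/subvPn => u _ uM; have u0 : u != 0.
  by apply: contraNneq uM => ->; rewrite mem0v.
have [|M' [[M'T uM'] _]] := solid_spread (P := <[u]>%VS).
  by rewrite dim_vline u0.
exists M'; split=> //; apply/eqP; apply: contraT => I0.
have /memv_capP[zM zM'] := memv_pick (val M :&: val M')%VS.
set z := vpick _ in zM zM'.
have [|N [_ NU]] := solid_spread (P := <[z]>%VS).
  by rewrite dim_vline vpick0 I0.
have MM' : M = M' by rewrite -(NU M) ?(NU M') // -memvE.
by rewrite MM' memvE uM' in uM.
Qed.

Lemma solid_elliptic (M0 : pline V) :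
  (plucker w M0 <= T)%VS -> elliptic_section w T.
Proof.
move=> M0T; have notC P u v : klein_quadric w P -> P = <[w u v]>%VS ->
    w u v \notin C.
  move=> QP PE; apply/negP; rewrite memvE -PE => PC.
  exact: C_external (klein_quadric_dim QP) PC QP.
split.
- by exists (plucker w M0); split=> //; exists M0.
- by move=> P [/klein_quadric_dim].
- have [e eB] := basis4_exists.
  have [f fw] := plucker_coordinates_exist ext2 e.
  move=> L dimL LT P1 P2 P3 [Q1 _] [Q2 _] [Q3 _].
  have [u1 [v1 [x10 E1]]] := klein_quadric_vector Q1.
  have [u2 [v2 [x20 E2]]] := klein_quadric_vector Q2.
  have [u3 [v3 [x30 E3]]] := klein_quadric_vector Q3.
  rewrite E1 E2 E3 -!memvE => x1L x2L x3L.
  apply: (collinear_points eB fw dimL LT) => //.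
  - exact: notC E1.
  - exact: pfaffian_wedge fw _ _.
  - exact: pfaffian_wedge fw _ _.
  - exact: pfaffian_wedge fw _ _.
move=> _ [[M ->] MT]; have [M' [M'T skew]] := skew_line MT.
(* In a basis of [V] composed of bases of the two skew lines, the polar form of
   their images is 1. *)
have [[u [v bM]] [u' [v' bM']]] := (pline_basis M, pline_basis M').
pose e := [tuple u; v; u'; v'].
have eB : basis_of {:V} e.
  have := cat_basis (introT directv_addP skew) bM bM'.
  suff -> : (val M + val M')%VS = {:V}%VS by [].
  apply/eqP; rewrite eqEdim subvf dimV dimv_disjoint_sum //.
  by rewrite (eqP (valP M)) (eqP (valP M')).
have [f fw] := plucker_coordinates_exist ext2 e.
have pE := plucker_basis ext2 bM; rewrite pE.
have yE := plucker_basis ext2 bM'.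
apply: (tangent_plane eB fw (y0 := w u' v')).
- by rewrite memvE -pE.
- by apply: notC pE; exists M.
- exact: pfaffian_wedge fw _ _.
- by rewrite memvE -yE.
have ce (i : 'I_4) (j : nat) : (j < 4)%N -> coord e i e`_j = (i == j :> nat)%:R.
  by move=> lt; rewrite (coord_free (Ordinal lt) i (basis_free eB)) eq_sym.
have cu i : coord e i u = (i == 0 :> nat)%:R by exact: (ce i 0).
have cv i : coord e i v = (i == 1 :> nat)%:R by exact: (ce i 1).
have cu' i : coord e i u' = (i == 2 :> nat)%:R by exact: (ce i 2).
have cv' i : coord e i v' = (i == 3 :> nat)%:R by exact: (ce i 3).
rewrite /pfaffian_polar !fw !cu !cv !cu' !cv' /=.
by rewrite !(mul0r, mulr0, mulr1, subr0, sub0r, addr0, add0r, oppr0) oner_neq0.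
Qed.

End Solid.

Lemma dim_span_plucker (M : pline V) : \dim (C + plucker w M) = 4%N.
Proof.
have QM : klein_quadric w (plucker w M) by exists M.
have dM := klein_quadric_dim QM; apply/eqP; rewrite eqn_leq; apply/andP; split.
  by have := dimv_add_leqif C (plucker w M); rewrite dimC dM => -[].
rewrite -dimC (ltn_leqif (dimv_leqif_sup (addvSl C (plucker w M)))).
by rewrite subv_add subvv (negPf (plucker_external M)).
Qed.

Lemma parallelE (M N : pline V) :
  parallel w C M N <-> (plucker w N <= C + plucker w M)%VS.
Proof.
split=> [->|NM]; first exact: addvSr.
apply/eqP; rewrite eq_sym eqEdim !dim_span_plucker leqnn andbT.
by rewrite subv_add addvSl.
Qed.

End External.
End KleinQuadric.

Theorem proposition4p3 (F : fieldType) (V W : vectType F) (w : V -> V -> W)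
    (dimV : \dim {:V}%VS = 4%N) (ext2 : is_exterior_square w)
    (C : {vspace W}) (dimC : \dim C = 3%N)
    (C_external : forall P : {vspace W},
        \dim P = 1%N -> (P <= C)%VS -> ~ klein_quadric w P) :
  is_parallelism (parallel w C) /\
  forall S : pline V -> Prop,
    parallel_class (parallel w C) S -> is_regular_spread w S.
Proof.
have main S : parallel_class (parallel w C) S -> is_regular_spread w S.
  case=> M SM; pose T := (C + plucker w M)%VS.
  have dimT : \dim T = 4%N.
    exact: (dim_span_plucker dimV ext2 dimC C_external).
  have CT : (C <= T)%VS by exact: addvSl.
  have ST N : S N <-> (plucker w N <= T)%VS.
    by rewrite SM; exact: (parallelE dimV ext2 dimC C_external).
  split; last first.
    exists T; split=> //.
    apply: (solid_elliptic dimV ext2 dimC C_external dimT CT (M0 := M)).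
    exact: addvSr.
  move=> P dimP.
  have [N [[NT PN] NU]] := solid_spread dimV ext2 dimC C_external dimT CT dimP.
  exists N; split; first by split; first exact/ST.
  by move=> N' [/ST N'T PN']; apply: NU.
split=> //; split; last by move=> S /main [].
by split=> [M|M N|M N K]; rewrite /parallel // => ->.
Qed.
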